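(* Let $k\in\{1,2\}$. If $\omega$ is a regular $k$-germ in $D$ and $\omega\approx_{\mathsf{v}}0$ for some $k$-Dini gauge $\mathsf{v}$ on $k$-simplices in $D$, then $\omega=0$.
   Context: Let $D\subseteq\mathbb{R}^d$ be a set. A $k$-simplex in $D$ is a tuple $S=[p_0p_1\ldots p_k]\in D^{k+1}$ with $\operatorname{conv}(S)\subseteq D$; $\operatorname{Simp}^k(D)$ is the set of $k$-simplices, and $\operatorname{Chain}^k(D)$ the real vector space generated by them. A $k$-germ in $D$ is a function $\omega:\operatorname{Simp}^k(D)\to\mathbb{R}$, written $\omega_S=\langle S,\omega\rangle$ and extended linearly to chains. The boundary is $\partial[p_0\ldots p_k]=\sum_{i=0}^k(-1)^i[p_0\ldots\hat p_i\ldots p_k]$, and $\langle S,\delta\omega\rangle:=\langle\partial S,\omega\rangle$ for $S\in \operatorname{Simp}^{k+1}(D)$. For $S=[p_0\ldots p_k]$, $\operatorname{vol}_k(S)=\frac1{k!}\sqrt{\det(PP^T)}$, where $P$ is the matrix with rows $p_i-p_0$, $i=1,\dots,k$. A $k$-germ $\omega$ is nonatomic if $\omega_S=0$ whenever $\operatorname{vol}_k(S)=0$; it is closed on $k$-planes if for every affine $\varphi:I\subseteq\mathbb{R}^k\to D$ the germ $S\mapsto\omega_{\varphi_\natural S}$ on $\operatorname{Simp}^k(I)$ has $\delta$ equal to $0$, where $\varphi_\natural[p_0\ldots p_k]=[\varphi(p_0)\ldots\varphi(p_k)]$; it is regular if it is nonatomic and closed on $k$-planes. A $k$-gauge is a nonnegative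 $k$-germ $\mathsf{v}$; it is uniform if it takes equal values on $k$-simplices $S,S'$ in $D$ that are isometric, i.e. there is an isometry of $\mathbb{R}^d$ mapping the $j$-th vertex of $S$ to the $j$-th vertex of $S'$ for all $j$. $[\omega]_{\mathsf{v}}\in[0,\infty]$ is the infimum of constants $c\ge 0$ with $|\omega_S|\le c\,\mathsf{v}_S$ for all $S$; $\omega\approx_{\mathsf{v}}\tilde\omega$ means $[\omega-\tilde\omega]_{\mathsf{v}}<\infty$. $(\lambda)_\natural S$ is the image of $S$ under $x\mapsto\lambda x$; for a uniform gauge $\langle(2^{-n})_\natural S,\mathsf{v}\rangle$ is understood as the value on any translated copy of $(2^{-n})_\natural S$ contained in $D$. A gauge $\mathsf{v}$ is $r$-Dini ($r\ge0$) if it is uniform and $\lim_{n\to\infty}2^{nr}\langle(2^{-n})_\natural S,\mathsf{v}\rangle=0$ for every simplex $S$ (of the relevant dimension) in $D$. *)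

(* Defs.v *)
From mathcomp Require Import freeg. (* first: it shadows [fintype.lift] *)
From mathcomp Require Import all_boot all_order all_algebra.
From mathcomp Require Import all_classical all_reals all_analysis.

Set Implicit Arguments.
Unset Strict Implicit.
Unset Printing Implicit Defensive.

Import Order.TTheory GRing.Theory Num.Theory.
Import numFieldNormedType.Exports.

Local Open Scope classical_set_scope.
Local Open Scope ring_scope.

Section Simplices.
Context {R : realType} {d : nat}.

Definition conv k (S : {ffun 'I_k.+1 -> 'rV[R]_d}) : set 'rV[R]_d :=
  [set \sum_i t i *: S i | t in
    [set t : 'I_k.+1 -> R | (forall i, 0 <= t i) /\ \sum_i t i = 1]].

Definition Simp k (D : set 'rV[R]_d) : set {ffun 'I_k.+1 -> 'rV[R]_d} :=
  [set S : {ffun _ -> _} | (forall i, D (S i)) /\ conv S `<=` D].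
#[global] Arguments Simp k D _ : clear implicits.

(* A simplex in D is an element of the set [Simp k D] seen as a type. *)
Definition vertices k (D : set 'rV[R]_d) (S : Simp k D) :
  {ffun 'I_k.+1 -> 'rV[R]_d} := val S.

Definition Chain k (D : set 'rV[R]_d) := {freeg (Simp k D) / R}.

Definition germ k (D : set 'rV[R]_d) := Simp k D -> R.

(* [fglift] is the linear extension of a function from generators to chains. *)
Definition pairing k (D : set 'rV[R]_d) (c : Chain k D) (w : germ k D) : R :=
  fglift (w : Simp k D -> R^o) c.

Lemma face_subproof k (D : set 'rV[R]_d) (S : Simp k.+1 D) (i : 'I_k.+2) :
  Simp k D [ffun j => vertices S (lift i j)].
Proof.
have [SD cD] := set_mem (valP S); split=> [j|_ [t [t0 t1] <-]].
  by rewrite ffunE; exact: SD.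
apply: cD; exists (fun j => oapp t 0 (unlift i j)); last first.
  rewrite (bigD1_ord i)//= unlift_none scale0r add0r.
  by apply: eq_bigr => j _; rewrite liftK ffunE.
split=> [j|] /=; first by case: (unlift i j).
rewrite (bigD1_ord i)//= unlift_none add0r -t1.
by apply: eq_bigr => j _; rewrite liftK.
Qed.

Definition face k (D : set 'rV[R]_d) (S : Simp k.+1 D) (i : 'I_k.+2) :
  Simp k D := SigSub (mem_set (face_subproof S i)).

Definition boundary k (D : set 'rV[R]_d) (S : Simp k.+1 D) : Chain k D :=
  \sum_(i < k.+2) << (-1) ^+ i *g face S i >>.

Definition coboundary k (D : set 'rV[R]_d) (w : germ k D) : germ k.+1 D :=
  fun S => pairing (boundary S) w.

Lemma coboundaryE k (D : set 'rV[R]_d) (w : germ k D) (S : Simp k.+1 D) :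
  coboundary w S = \sum_(i < k.+2) (-1) ^+ i * w (face S i).
Proof.
rewrite /coboundary /pairing /boundary; set f := fglift _.
have fB : {morph f : x y / x - y} := @lift_is_additive _ _ _ _.
have f0 : f 0 = 0 by rewrite -[X in f X](subrr 0) fB subrr.
have fN x : f (- x) = - f x by rewrite -[- x]sub0r fB f0 sub0r.
have fD : {morph f : x y / x + y}.
  by move=> x y; rewrite -{1}[y]opprK fB fN opprK.
by rewrite (big_morph f fD f0); apply: eq_bigr => i _; rewrite /f liftU.
Qed.

Definition vol k (S : {ffun 'I_k.+1 -> 'rV[R]_d}) : R :=
  let P := \matrix_(i < k) (S (lift ord0 i) - S ord0) in
  (k`!%:R)^-1 * Num.sqrt (\det (P *m P^T)).

Definition nonatomic k (D : set 'rV[R]_d) (w : germ k D) :=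
  forall S : Simp k D, vol (vertices S) = 0 -> w S = 0.

End Simplices.

Section AffineMaps.
Context {R : realType} {n d : nat}.

Record affine_map (I : set 'rV[R]_n) (D : set 'rV[R]_d) := AffineMap {
  affine_fun :> 'rV[R]_n -> 'rV[R]_d;
  affine_funP : exists (L : {linear 'rV[R]_n -> 'rV[R]_d}) (b : 'rV[R]_d),
    forall x, I x -> affine_fun x = L x + b;
  affine_fun_in : forall x, I x -> D (affine_fun x) }.

Lemma pushforward_subproof k (I : set 'rV[R]_n) (D : set 'rV[R]_d)
    (phi : affine_map I D) (S : Simp k I) :
  Simp k D [ffun j => phi (vertices S j)].
Proof.
have [SI cI] := set_mem (valP S); split=> [j|_ [t [t0 t1] <-]].
  by rewrite ffunE; apply: affine_fun_in; exact: SI.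
have [L [b phiE]] := affine_funP phi.
suff -> : \sum_i t i *: [ffun j => phi (vertices S j)] i =
          phi (\sum_i t i *: vertices S i).
  by apply: affine_fun_in; apply: cI; exists t.
rewrite phiE; last by apply: cI; exists t.
rewrite linear_sum -[b]scale1r -t1 scaler_suml -big_split /=.
by apply: eq_bigr => i _; rewrite ffunE phiE ?linearZ ?scalerDr//; exact: SI.
Qed.

Definition pushforward k (I : set 'rV[R]_n) (D : set 'rV[R]_d)
    (phi : affine_map I D) (S : Simp k I) : Simp k D :=
  SigSub (mem_set (pushforward_subproof phi S)).

Definition pullback k (I : set 'rV[R]_n) (D : set 'rV[R]_d)
    (phi : affine_map I D) (w : germ k D) : germ k I :=
  fun S => w (pushforward phi S).

End AffineMaps.

Section Germs.
Context {R : realType} {d k : nat}.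
Implicit Types D : set 'rV[R]_d.

Definition closed_on_planes D (w : germ k D) :=
  forall (I : set 'rV[R]_k) (phi : affine_map I D),
    coboundary (pullback phi w) = \0.

Definition regular_germ D (w : germ k D) := nonatomic w /\ closed_on_planes w.

Definition gauge D (v : germ k D) := forall S, 0 <= v S.

(* The library norm on ['rV[R]_d] is the sup norm, not the Euclidean one. *)
Definition euclid_dist (x y : 'rV[R]_d) : R :=
  Num.sqrt (\sum_i (x 0 i - y 0 i) ^+ 2).

Definition euclid_isometry (f : 'rV[R]_d -> 'rV[R]_d) :=
  forall x y, euclid_dist (f x) (f y) = euclid_dist x y.

Definition isometric (S S' : {ffun 'I_k.+1 -> 'rV[R]_d}) :=
  exists2 f, euclid_isometry f & forall j, f (S j) = S' j.

Definition uniform D (v : germ k D) := forall S S' : Simp k D,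
  isometric (vertices S) (vertices S') -> v S = v S'.

Definition seminorm D (v w : germ k D) : \bar R :=
  ereal_inf [set c%:E | c in
    [set c : R | 0 <= c /\ forall S, `|w S| <= c * v S]].

Definition germ_approx D (v w w' : germ k D) := (seminorm v (w \- w')%R < +oo)%E.

Definition scaled_copy D (l : R) (S T : Simp k D) :=
  exists a : 'rV[R]_d, forall i, vertices T i = l *: vertices S i + a.

Lemma scaled_copy_exists D (l : R) (S : Simp k D) :
  0 <= l <= 1 -> exists T : Simp k D, scaled_copy l S T.
Proof.
case/andP=> l0 l1; have [SD cD] := set_mem (valP S).
pose p := vertices S ord0.
pose T : {ffun 'I_k.+1 -> 'rV[R]_d} :=
  [ffun i => l *: vertices S i + (1 - l) *: p].
have convTS x : conv T x -> conv (vertices S) x.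
  move=> [t [t0 t1] <-].
  exists (fun i => l * t i + (1 - l) * (i == ord0)%:R).
    split=> [i|]; first by rewrite addr_ge0 ?mulr_ge0 ?subr_ge0.
    rewrite big_split /= -!mulr_sumr t1 (bigD1 ord0)//= big1 => [|i /negPf->//].
    by rewrite addr0 !mulr1 addrC subrK.
  transitivity (l *: (\sum_i t i *: vertices S i) + (1 - l) *: p).
    rewrite scaler_sumr; under eq_bigr do rewrite scalerDl -scalerA.
    rewrite big_split /=; congr (_ + _).
    rewrite (bigD1 ord0)//= mulr1 big1 ?addr0// => i /negPf->.
    by rewrite mulr0 scale0r.
  have -> : (1 - l) *: p = \sum_i t i *: ((1 - l) *: p).
    by rewrite -scaler_suml t1 scale1r.
  rewrite scaler_sumr -big_split /=; apply: eq_bigr => i _.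
  by rewrite ffunE scalerDr !scalerA (mulrC l).
have ST : Simp k D T.
  split=> [i|x /convTS]; last exact: cD.
  apply/cD/convTS; exists (fun j => (j == i)%:R).
    split=> [j//|]; rewrite (bigD1 i)//= eqxx big1 ?addr0// => j /negPf->//.
  rewrite (bigD1 i)//= eqxx scale1r big1 ?addr0// => j /negPf->.
  by rewrite scale0r.
exists (SigSub (mem_set ST)), ((1 - l) *: p) => i.
by rewrite /vertices /= ffunE.
Qed.

(* For a uniform gauge, [v (T n)] does not depend on the chosen translate
   [T n] of the n-th rescaling of S; translates in D exist by
   [scaled_copy_exists]. *)
Definition dini D (r : R) (v : germ k D) :=
  [/\ gauge v, uniform v &
    forall (S : Simp k D) (T : nat -> Simp k D),
      (forall n, scaled_copy (2 ^- n) S (T n)) ->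
      2 `^ (n%:R * r) * v (T n) @[n --> \oo] --> 0].

End Germs.

(* Main.v *)
From Pilot Require Import Defs.
From mathcomp Require Import all_boot all_order all_algebra.
From mathcomp Require Import all_classical all_reals all_analysis.
From mathcomp Require Import ring lra.
Local Open Scope classical_set_scope.
Local Open Scope ring_scope.

Set Implicit Arguments.
Unset Strict Implicit.
Unset Printing Implicit Defensive.

Import Order.TTheory GRing.Theory Num.Theory.
Import numFieldNormedType.Exports.

(** A simplex S of dimension 1 or 2 can be cut into 2^k congruent pieces, each
    of which is S scaled by 1/2 or by -1/2 and translated: the two halves of a
    segment, or the four triangles cut out of a triangle by the segments joining
    the midpoints of its sides, the central one being the one turned upside
    down.  A regular germ w is additive over this subdivision
    ([segment_halving], [triangle_halving]).

    Iterating n times ([halving_iter]), w S is a sum of 2^(nk) values of w on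
    copies of S scaled by 2^-n or by -2^-n.  Translations and the point
    reflection x |-> - x are isometries of the Euclidean space, so a uniform
    gauge v takes on all these copies the same value v_n ([uniform_copies]).
    If |w| <= c v, then |w S| <= c 2^(nk) v_n, and the k-Dini condition says
    that the right-hand side tends to 0 ([halving_vanish]).

    Additivity over the subdivision is a finite combination of cocycle
    identities: closedness on k-planes makes the alternating sum of w over the
    facets of any k+2 points of conv S vanish ([cocycle]), and nonatomicity
    removes the degenerate facets. *)

(* The name [conv] also denotes a convex combination of two points. *)
Local Notation conv := Pilot.Defs.conv.

(** * Points of the convex hull of a simplex *)

Section ConvexCombinations.
Context {R : realType} {d k : nat}.
Implicit Types (D : set 'rV[R]_d) (S : {ffun 'I_k.+1 -> 'rV[R]_d}).

Lemma conv_vertex S (i : 'I_k.+1) : conv S (S i).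
Proof.
exists (fun j => (j == i)%:R).
  by split=> [j //|]; rewrite (bigD1 i) //= eqxx big1 ?addr0 // => j /negPf->.
rewrite (bigD1 i) //= eqxx scale1r big1 ?addr0 // => j /negPf->.
by rewrite scale0r.
Qed.

Lemma conv_conv n (X : {ffun 'I_n.+1 -> 'rV[R]_d}) S :
  (forall j, conv S (X j)) -> conv X `<=` conv S.
Proof.
move=> SX _ [t [t0 t1] <-].
have /choice[y yP] : forall j, exists y : 'I_k.+1 -> R,
    [/\ forall i, 0 <= y i, \sum_i y i = 1 & \sum_i y i *: S i = X j].
  by move=> j; have [y [y0 y1] yX] := SX j; exists y.
exists (fun i => \sum_j t j * y j i).
  split=> [i|].
    by apply: sumr_ge0 => j _; rewrite mulr_ge0 //; case: (yP j).
  rewrite exchange_big -t1 /=; apply: eq_bigr => j _.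
  by rewrite -mulr_sumr; case: (yP j) => _ -> _; rewrite mulr1.
under eq_bigr do rewrite scaler_suml.
rewrite exchange_big /=; apply: eq_bigr => j _.
have [_ _ <-] := yP j; rewrite scaler_sumr.
by apply: eq_bigr => i _; rewrite scalerA.
Qed.

Lemma conv_midpoint S x y : conv S x -> conv S y -> conv S (2^-1 *: (x + y)).
Proof.
move=> [s [s0 s1] <-] [t [t0 t1] <-].
exists (fun i => 2^-1 * (s i + t i)).
  split=> [i|]; first by rewrite mulr_ge0 ?invr_ge0 ?addr_ge0.
  by rewrite -mulr_sumr big_split /= s1 t1; field.
rewrite -big_split scaler_sumr; apply: eq_bigr => i _ /=.
by rewrite -scalerA scalerDl.
Qed.

Lemma Simp_in_conv n D S (X : {ffun 'I_n.+1 -> 'rV[R]_d}) :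
  Simp k D S -> (forall j, conv S (X j)) -> Simp n D X.
Proof.
move=> [_ cD] SX; split=> [j|x /(conv_conv SX)]; last exact: cD.
exact/cD/SX.
Qed.

End ConvexCombinations.

(** * Closed germs as cocycles, and vanishing by repeated halving *)

Section Vanishing.
Context {R : realType} {d k : nat}.
Implicit Types D : set 'rV[R]_d.

(** A linear relation between the edge vectors is a kernel vector of their Gram
    matrix. *)
Lemma vol_dependent (S : {ffun 'I_k.+1 -> 'rV[R]_d}) (u : 'rV[R]_k) :
  u != 0 -> \sum_i u 0 i *: (S (lift ord0 i) - S ord0) = 0 -> vol S = 0.
Proof.
move=> u0 uS; rewrite /vol; set P := \matrix_(i < k) _.
have uP : u *m P = 0.
  by rewrite mulmx_sum_row -[RHS]uS; apply: eq_bigr => i _; rewrite rowK.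
have /eqP-> : \det (P *m P^T) == 0.
  by apply/det0P; exists u => //; rewrite mulmxA uP mul0mx.
by rewrite sqrtr0 mulr0.
Qed.

(** Extension of [w] by zero to all tuples of points: values of [w] can then be
    written and combined without carrying proofs that tuples are simplices
    in [D]. *)
Definition germ_at D (w : germ k D) (X : {ffun 'I_k.+1 -> 'rV[R]_d}) : R :=
  oapp w 0 (insub X).

Lemma germ_at_vertices D (w : germ k D) (S : Simp k D) :
  germ_at w (vertices S) = w S.
Proof. by rewrite /germ_at /vertices valK. Qed.

Lemma germ_atE D (w : germ k D) X : Simp k D X ->
  exists2 S : Simp k D, vertices S = X & germ_at w X = w S.
Proof.
move=> DX; exists (SigSub (mem_set DX)) => //.
by rewrite -germ_at_vertices.
Qed.

(** Barycentric coordinates parametrize conv S by the standard simplex of R^k,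
    and this affine map pushes a (k+1)-tuple of coordinate vectors to the given
    points, so closedness on k-planes applies; S may be degenerate. *)
Lemma cocycle D (w : germ k D) (S : {ffun 'I_k.+1 -> 'rV[R]_d})
    (X : {ffun 'I_k.+2 -> 'rV[R]_d}) :
  closed_on_planes w -> Simp k D S -> (forall j, conv S (X j)) ->
  \sum_(j < k.+2) (-1) ^+ j * germ_at w [ffun l => X (lift j l)] = 0.
Proof.
move=> wcl [_ cD] SX.
pose L0 (x : 'rV[R]_k) := x *m \matrix_(i < k) (S (lift ord0 i) - S ord0).
pose phi x := L0 x + S ord0.
pose I : set 'rV[R]_k := [set x | (forall i, 0 <= x 0 i) /\ \sum_i x 0 i <= 1].
have phiE (t : 'I_k.+1 -> R) : \sum_i t i = 1 ->
    phi (\row_i t (lift ord0 i)) = \sum_i t i *: S i.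
  move=> t1; rewrite /phi /L0 mulmx_sum_row big_ord_recl /=.
  have -> : t ord0 = 1 - \sum_(i < k) t (lift ord0 i).
    by rewrite -t1 big_ord_recl addrK.
  rewrite scalerBl scale1r scaler_suml addrC -addrA; congr (_ + _).
  rewrite [RHS]addrC -sumrB; apply: eq_bigr => i _.
  by rewrite rowK mxE scalerBr.
have phiI x : I x -> D (phi x).
  move=> [x0 x1]; apply: cD.
  (* The barycentric coordinates of phi x; the one at the origin vertex is what
     the others leave over. *)
  pose t i := oapp (x 0) (1 - \sum_i x 0 i) (unlift ord0 i).
  have t1 : \sum_i t i = 1.
    rewrite big_ord_recl /t unlift_none /=.
    by under [X in _ + X]eq_bigr do rewrite liftK /=; rewrite subrK.
  exists t; first split=> // i.
    by rewrite /t; case: unliftP => [j|] _ /=; rewrite ?subr_ge0.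
  rewrite -phiE //; congr phi; apply/rowP => i.
  by rewrite mxE /t liftK.
have Laff : exists (L : {linear 'rV[R]_k -> 'rV[R]_d}) (b : 'rV[R]_d),
    forall x, I x -> phi x = L x + b.
  by exists (mulmxr (\matrix_(i < k) (S (lift ord0 i) - S ord0))), (S ord0).
pose f : affine_map I D := AffineMap Laff phiI.
have /choice[y yP] : forall j, exists y : 'I_k.+1 -> R,
    [/\ forall i, 0 <= y i, \sum_i y i = 1 & \sum_i y i *: S i = X j].
  by move=> j; have [y [y0 y1] yX] := SX j; exists y.
pose Y : {ffun 'I_k.+2 -> 'rV[R]_k} := [ffun j => \row_i y j (lift ord0 i)].
have YI j : I (Y j).
  have [y0 y1 _] := yP j; split=> [i|]; first by rewrite ffunE mxE.
  under eq_bigr do rewrite ffunE mxE.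
  by rewrite -y1 big_ord_recl lerDr.
have SY : Simp k.+1 I Y.
  split=> // _ [t [t0 t1] <-]; split=> [i|].
    by rewrite summxE; apply: sumr_ge0 => j _; rewrite mxE mulr_ge0 //; case: (YI j).
  under eq_bigr do rewrite summxE.
  rewrite exchange_big -t1 /=; apply: ler_sum => j _.
  under eq_bigr do rewrite mxE.
  by rewrite -mulr_sumr ler_piMr //; case: (YI j).
have /(congr1 (fun g => g (SigSub (mem_set SY)))) := wcl I f.
rewrite coboundaryE => E; rewrite -[RHS]E; apply: eq_bigr => j _; congr (_ * _).
rewrite /pullback -germ_at_vertices; congr germ_at.
apply/ffunP => l; rewrite /pushforward /face /vertices /= !ffunE /=.
by have [_ y1 <-] := yP (lift j l); rewrite phiE.
Qed.

Lemma germ_at_dependent D (w : germ k D) X (u : 'rV[R]_k) :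
  nonatomic w -> Simp k D X -> u != 0 ->
  \sum_i u 0 i *: (X (lift ord0 i) - X ord0) = 0 -> germ_at w X = 0.
Proof.
move=> wna /(germ_atE w)[S SX ->] u0 uX.
by apply: wna; apply: (vol_dependent u0); rewrite SX.
Qed.

(** Here l' = e l for a sign e, and x |-> e (x - a) + a' is an isometry when
    e = 1 or e = -1. *)
Lemma uniform_copies D (v : germ k D) (S T T' : Simp k D) (l l' : R) :
  uniform v -> `|l| = `|l'| -> scaled_copy l S T -> scaled_copy l' S T' ->
  v T = v T'.
Proof.
move=> vu ll' [a Ta] [a' Ta']; apply: vu.
have [e e2 l'E] : exists2 e : R, e ^+ 2 = 1 & l' = e * l.
  move/eqP: ll'; rewrite eqr_norm2 => /orP[]/eqP->.
    by exists 1; rewrite ?expr1n ?mul1r.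
  by exists (-1); rewrite ?sqrrN ?expr1n // mulN1r opprK.
exists (fun x => e *: (x - a) + a') => [x y|j].
  congr Num.sqrt; apply: eq_bigr => i _; rewrite !mxE.
  transitivity (e ^+ 2 * (x 0 i - y 0 i) ^+ 2); first by ring.
  by rewrite e2 mul1r.
by rewrite Ta Ta' addrK scalerA l'E.
Qed.

Lemma scaled_copy_trans D (S T U : Simp k D) (l m : R) :
  scaled_copy l S T -> scaled_copy m T U -> scaled_copy (m * l) S U.
Proof.
move=> [a Ta] [b Ub]; exists (m *: a + b) => i.
by rewrite Ub Ta scalerDr scalerA addrA.
Qed.

(** The bound on [w S] that follows from cutting S into 2^k copies of itself
    scaled by 1/2 or -1/2, when [w] is additive over the pieces.  Negative
    ratios are allowed because of the central piece of a triangle. *)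
Definition halving D (w : germ k D) := forall (S : Simp k D) (B : R),
  (forall (T : Simp k D) l, `|l| = 2^-1 -> scaled_copy l S T -> `|w T| <= B) ->
  `|w S| <= 2 ^+ k * B.

Lemma halving_iter D (w : germ k D) n (S : Simp k D) (B : R) : halving w ->
  (forall (T : Simp k D) l, `|l| = 2 ^- n -> scaled_copy l S T -> `|w T| <= B) ->
  `|w S| <= 2 ^+ (n * k) * B.
Proof.
move=> wh; elim: n => [|n IHn] in S B * => wB.
  rewrite mul1r; apply: (wB S 1); first by rewrite normr1 invr1.
  by exists 0 => i; rewrite scale1r addr0.
rewrite mulSn exprD -mulrA; apply: wh => T l lE ST; apply: IHn => U m mE TU.
apply: (wB U (m * l)); last exact: scaled_copy_trans ST TU.
by rewrite normrM lE mE exprSr invfM mulrC.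
Qed.

(** The number 2^(nk) of pieces after n halvings is exactly what the k-Dini
    condition compensates for. *)
Lemma halving_vanish D (w v : germ k D) :
  halving w -> dini k%:R v -> germ_approx v w \0 -> w = \0.
Proof.
move=> wh [v0 vu vlim] /ereal_inf_lt[_ [c [c0 wv] <-] _].
apply/funext => S; apply/eqP; rewrite -normr_le0.
have /choice[T ST] n : exists T : Simp k D, scaled_copy (2 ^- n : R) S T.
  apply: scaled_copy_exists.
  by rewrite invr_ge0 exprn_ge0 //= invf_le1 ?exprn_gt0 // exprn_ege1 ?ler1n.
have wT n : `|w S| <= c * (2 `^ (n%:R * k%:R) * v (T n)).
  rewrite -natrM powR_mulrn // mulrCA; apply: halving_iter => // U l lE SU.
  have := wv U; rewrite /= subr0 => /le_trans; apply.
  suff -> : v U = v (T n) by [].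
  apply: uniform_copies SU (ST n) => //.
  by rewrite lE ger0_norm // invr_ge0 exprn_ge0.
have cv0 : c * (2 `^ (n%:R * k%:R) * v (T n)) @[n --> \oo] --> 0.
  by rewrite -[X in _ --> X](mulr0 c); apply: cvgMl_tmp; apply: vlim.
by apply: (cvgr_to_ge cv0); apply: nearW.
Qed.

End Vanishing.

(** * Midpoint subdivision of segments and triangles *)

Section Subdivision.
Context {R : realType} {d : nat}.
Implicit Types (D : set 'rV[R]_d) (a b c e m x y z : 'rV[R]_d).

Definition simplex n (s : seq 'rV[R]_d) : {ffun 'I_n -> 'rV[R]_d} :=
  [ffun j : 'I_n => s`_j].

Lemma scale_halves x : x = 2^-1 *: x + 2^-1 *: x.
Proof. by rewrite -scalerDl -[LHS]scale1r; congr (_ *: _); field. Qed.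

Lemma ler_norm_sum2 (s t B B' : R) :
  `|s| <= B -> `|t| <= B' -> `|s + t| <= B + B'.
Proof. by move=> sB tB; apply: le_trans (ler_normD _ _) (lerD sB tB). Qed.

Section Segment.
Variables (D : set 'rV[R]_d) (w : germ 1 D) (S : Simp 1 D).
Hypothesis wcl : closed_on_planes w.
Let C := conv (vertices S).
Let g a b := germ_at w (simplex 2 [:: a; b]).

Lemma segment_cocycle a b c : C a -> C b -> C c -> g b c - g a c + g a b = 0.
Proof.
move=> Ca Cb Cc.
have SX j : C (simplex 3 [:: a; b; c] j) by rewrite ffunE; case: j => [[|[|[|//]]] ?].
rewrite -[RHS](cocycle wcl (set_mem (valP S)) SX) 3!big_ord_recl big_ord0 /=.
rewrite /g expr0 expr1 expr2 mul1r mulN1r mulrNN !mul1r addr0 addrA.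
by congr (_ - _ + _); congr germ_at;
  apply/ffunP => [[[|[|//]] ?]]; rewrite !ffunE.
Qed.

End Segment.

(** The cocycle identity for the two endpoints and the midpoint says that [w]
    is the sum of its values on the two halves. *)
Lemma segment_halving D (w : germ 1 D) : closed_on_planes w -> halving w.
Proof.
move=> wcl S B wB; rewrite expr1.
set X := vertices S; set a := X ord0; set b := X ord_max.
have XE : X = simplex 2 [:: a; b].
  by apply/ffunP => [[[|[|//]] i]]; rewrite ffunE; congr (X _); apply: val_inj.
have Ca : conv X a := conv_vertex X _; have Cb : conv X b := conv_vertex X _.
have Cm := conv_midpoint Ca Cb.
have half p q e : conv X p -> conv X q ->
    p = 2^-1 *: a + e -> q = 2^-1 *: b + e ->
    `|germ_at w (simplex 2 [:: p; q])| <= B.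
  move=> Cp Cq pE qE.
  have /(germ_atE w)[T TE ->] : Simp 1 D (simplex 2 [:: p; q]).
    apply: (Simp_in_conv (set_mem (valP S))) => j.
    by rewrite ffunE; case: j => [[|[|//]] ?].
  apply: (wB T (2^-1)); first by rewrite ger0_norm ?invr_ge0.
  exists e => i; rewrite TE -/X XE !ffunE.
  by case: i => [[|[|//]] ?].
have := segment_cocycle wcl Ca Cm Cb; rewrite -germ_at_vertices -/X XE.
have h1 := half _ _ (2^-1 *: a) Ca Cm.
have h2 := half _ _ (2^-1 *: b) Cm Cb.
move: h1 h2; set u := germ_at _ _; set v := germ_at _ _; set t := germ_at _ _ => h1 h2.
move=> E; have -> : t = u + v by lra.
rewrite mulr_natl mulr2n; apply: ler_norm_sum2.
  by apply: h1; rewrite -?scale_halves // scalerDr addrC.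
by apply: h2; rewrite -?scale_halves // scalerDr.
Qed.

Section Triangle.
Variables (D : set 'rV[R]_d) (w : germ 2 D) (S : Simp 2 D).
Hypothesis wreg : regular_germ w.
Let C := conv (vertices S).
Let g a b c := germ_at w (simplex 3 [:: a; b; c]).

Lemma triangle_in a b c : C a -> C b -> C c -> Simp 2 D (simplex 3 [:: a; b; c]).
Proof.
move=> Ca Cb Cc; apply: (Simp_in_conv (set_mem (valP S))) => j.
by rewrite ffunE; case: j => [[|[|[|//]]] ?].
Qed.

Lemma triangle_cocycle a b c e : C a -> C b -> C c -> C e ->
  g b c e - g a c e + g a b e - g a b c = 0.
Proof.
move=> Ca Cb Cc Ce.
have SX j : C (simplex 4 [:: a; b; c; e] j).
  by rewrite ffunE; case: j => [[|[|[|[|//]]]] ?].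
rewrite -[RHS](cocycle wreg.2 (set_mem (valP S)) SX) 4!big_ord_recl big_ord0 /=.
rewrite /g !exprS expr0 !mulN1r !mulNr !mul1r !opprK addr0 !addrA.
by congr (_ - _ + _ - _); congr germ_at;
  apply/ffunP => [[[|[|[|//]]] ?]]; rewrite !ffunE.
Qed.

Lemma triangle_dependent a b c (s t : R) : C a -> C b -> C c ->
  (s, t) != (0, 0) -> s *: (b - a) + t *: (c - a) = 0 -> g a b c = 0.
Proof.
move=> Ca Cb Cc st0 stE.
apply: (germ_at_dependent (u := \row_i [:: s; t]`_i) wreg.1 (triangle_in Ca Cb Cc)).
  apply: contra st0 => /eqP/rowP u0.
  by have := u0 0; have := u0 1; rewrite !mxE /= => -> ->.
by rewrite 2!big_ord_recl big_ord0 addr0 !mxE !ffunE /=.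
Qed.

Lemma triangle_flat a b : C a -> C b -> g a b a = 0.
Proof.
move=> Ca Cb; apply: (@triangle_dependent _ _ _ 0 1) => //.
  by rewrite xpair_eqE oner_eq0 andbF.
by rewrite scale0r subrr scaler0 addr0.
Qed.

Lemma triangle_midpoint a b : C a -> C b -> g a (2^-1 *: (a + b)) b = 0.
Proof.
move=> Ca Cb; apply: (@triangle_dependent _ _ _ 2 (-1)) => //.
- exact: conv_midpoint.
- by rewrite xpair_eqE pnatr_eq0.
by apply/rowP => i; rewrite !mxE; field.
Qed.

(** The cocycle identity for a, b, c, a, two facets of which are flat. *)
Lemma triangle_cyclic a b c : C a -> C b -> C c -> g a b c = g b c a.
Proof.
move=> Ca Cb Cc; have := triangle_cocycle Ca Cb Cc Ca.
by rewrite !triangle_flat //; lra.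
Qed.

(** The medial subdivision, with p, q, r the midpoints opposite to a, b, c, and
    with the vertices of each piece listed in the order of those of a b c.
    The triangle is first cut along the median a p; the halves a b p and a p c
    are cut by p r and p q.  This isolates the pieces at b and at c and leaves
    the quadrilateral a r p q cut along its diagonal a p.  The cocycle identity
    for its four vertices replaces that diagonal by r q. *)
Lemma triangle_medial a b c : C a -> C b -> C c ->
  let p := 2^-1 *: (b + c) in let q := 2^-1 *: (a + c) in
  let r := 2^-1 *: (a + b) in
  g a b c = g a r q + g r b p + g q p c + g p q r.
Proof.
move=> Ca Cb Cc p q r.
have Cp : C p by exact: conv_midpoint.
have Cq : C q by exact: conv_midpoint.
have Cr : C r by exact: conv_midpoint.
have cut_p := triangle_cocycle Ca Cb Cp Cc.
have cut_r := triangle_cocycle Ca Cr Cb Cp.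
have cut_q := triangle_cocycle Cq Ca Cp Cc.
have flip := triangle_cocycle Ca Cr Cp Cq.
have bpc : g b p c = 0 by exact: triangle_midpoint.
have arb : g a r b = 0 by exact: triangle_midpoint.
have qac : g q a c = 0.
  rewrite triangle_cyclic // triangle_cyclic // /q [a + c]addrC.
  exact: triangle_midpoint.
have := triangle_cyclic Cq Ca Cp; have := triangle_cyclic Cr Cp Cq.
by lra.
Qed.

End Triangle.

Lemma triangle_halving D (w : germ 2 D) : regular_germ w -> halving w.
Proof.
move=> wreg S B wB.
set X := vertices S; set a := X ord0; set b := X 1; set c := X ord_max.
have XE : X = simplex 3 [:: a; b; c].
  by apply/ffunP => [[[|[|[|//]]] i]]; rewrite ffunE; congr (X _); apply: val_inj.
have Ca : conv X a := conv_vertex X _; have Cb : conv X b := conv_vertex X _.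
have Cc : conv X c := conv_vertex X _.
have Cp := conv_midpoint Cb Cc; have Cq := conv_midpoint Ca Cc.
have Cr := conv_midpoint Ca Cb.
have half (l : R) e x y z : `|l| = 2^-1 -> conv X x -> conv X y -> conv X z ->
    x = l *: a + e -> y = l *: b + e -> z = l *: c + e ->
    `|germ_at w (simplex 3 [:: x; y; z])| <= B.
  move=> lE Cx Cy Cz xE yE zE.
  have [T TE ->] := germ_atE w (triangle_in Cx Cy Cz).
  apply: (wB T l lE); exists e => i; rewrite TE -/X XE !ffunE.
  by case: i => [[|[|[|//]]] ?].
have h2 : `|2^-1| = 2^-1 :> R by rewrite ger0_norm ?invr_ge0.
rewrite -germ_at_vertices -/X XE (triangle_medial wreg Ca Cb Cc) /=.
have -> : 2 ^+ 2 * B = B + B + B + B by ring.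
apply: ler_norm_sum2; [apply: ler_norm_sum2; [apply: ler_norm_sum2|]|].
- by apply: (half 2^-1 (2^-1 *: a)); rewrite -?scale_halves // scalerDr addrC.
- by apply: (half 2^-1 (2^-1 *: b)); rewrite -?scale_halves // scalerDr addrC.
- by apply: (half 2^-1 (2^-1 *: c)); rewrite -?scale_halves // scalerDr addrC.
(* The central piece p q r is the image of a b c under the homothety of ratio
   -1/2 about the common barycentre. *)
apply: (half (- 2^-1) (2^-1 *: (a + b + c))) => //;
  first by rewrite normrN.
all: by apply/rowP => i; rewrite !mxE; ring.
Qed.

End Subdivision.

Theorem theorem3p12 (R : realType) (d k : nat) (hk : k = 1%N \/ k = 2%N)
    (D : set 'rV[R]_d) (w : germ k D) (hw : regular_germ w)
    (happrox : exists2 v : germ k D, dini k%:R v & germ_approx v w \0) :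
  w = \0.
Proof.
have [v vdini wv] := happrox; apply: (halving_vanish _ vdini wv).
case: hk => kE; rewrite kE in w hw v vdini wv happrox *.
  exact: segment_halving hw.2.
exact: triangle_halving.
Qed.
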